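(* Let $V$ be a finite ground set, let $f:2^V\to\mathbb{R}_{\ge 0}$ be normalized, monotone and submodular, and let $\mathcal{A}$ be a subroutine satisfying the $\beta$-iterative property for some $\beta\ge 1$. Let $k$ be a budget and let $\tau,\eta$ be parameters with $\eta\in\mathbb{N}_+$, $\eta\ge 4(\log k+1)$ and $2\le \tau\le \frac{k}{3\eta(\log k+2)}$. Then PRo (run with inputs $V,k,\tau,\eta,\mathcal{A}$) returns a set $S=S_0\cup S_1$ of size $k$ such that, writing $$c:=\frac{\eta}{5\beta^3\lceil\log\tau\rceil+\eta}\left(1-e^{-\frac{k-|S_0|}{\beta(k-\tau)}}\right),$$ we have $$f(S\setminus E^*_S)\ \ge\ \frac{c}{1+c}\; f\big(\mathrm{OPT}(k,V,\tau)\setminus E^*_{\mathrm{OPT}(k,V,\tau)}\big).$$ In addition, if $\tau=o\!\left(\frac{k}{\eta\log k}\right)$ and $\eta\ge\log^2 k$, then as $k\to\infty$, $$f(S\setminus E^*_S)\ \ge\ \left(\frac{1-e^{-1/\beta}}{2-e^{-1/\beta}}+o(1)\right) f\big(\mathrm{OPT}(k,V,\tau)\setminus E^*_{\mathrm{OPT}(k,V,\tau)}\big).$$ In particular, with the greedy algorithm as subroutine ($\beta=1$) the asymptotic approximation factor is at least $0.387$, and with a subroutine satisfying the $\beta$-iterative property with $\beta=1/(1-\epsilon)$ (such as Thresholding-Greedy with parameter $\epsilon$) it is at least $0.387(1-\epsilon)$.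
   Context: Notation: $f$ is normalized if $f(\emptyset)=0$; $f(Y\mid X):=f(X\cup Y)-f(X)$ and $f(e\mid X):=f(\{e\}\mid X)$. All logarithms are to base 2. A subroutine $\mathcal{A}(k',T)$ takes a cardinality $k'$ and a set $T\subseteq V$ and outputs an ordered set $(v_1,\dots,v_{k'})$ of elements of $T$; write $\mathcal{A}_i(T)=\{v_1,\dots,v_i\}$. $\mathcal{A}$ satisfies the $\beta$-iterative property if for every $T$, every output size and every $i$, $f(\mathcal{A}_{i+1}(T))-f(\mathcal{A}_i(T))\ge \frac{1}{\beta}\max_{v\in T} f(v\mid \mathcal{A}_i(T))$. (The standard greedy algorithm, which adds an element of maximum marginal gain at each step, satisfies it with $\beta=1$.) Algorithm PRo (inputs $V,k,\tau,\eta\in\mathbb{N}_+,\mathcal{A}$): set $S_0\leftarrow\emptyset$; for $i=0,1,\dots,\lceil\log\tau\rceil$ and, for each such $i$, for $j=1,\dots,\lceil\tau/2^i\rceil$: let $B_j\leftarrow\mathcal{A}(2^i\eta, V\setminus S_0)$ and $S_0\leftarrow S_0\cup B_j$. Then $S_1\leftarrow\mathcal{A}(k-|S_0|, V\setminus S_0)$, and output $S=S_0\cup S_1$. For $k$ and $T\subseteq V$, $\mathrm{OPT}(k,V,\tau)\in\arg\max_{S\subseteq V,|S|=k}\min_{E\subseteq S,|E|\le\tau} f(S\setminus E)$, and for a set $S$, $E^*_S\in\arg\min_{E\subseteq S,|E|\le\tau} f(S\setminus E)$. *)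

(* Defs.v *)
From mathcomp Require Import all_boot all_order all_algebra.
From mathcomp Require Import reals sequences exp.
Set Implicit Arguments. Unset Strict Implicit. Unset Printing Implicit Defensive.
Import Order.TTheory GRing.Theory Num.Theory.
Local Open Scope ring_scope.

Section Defs.
Variable R : realType.
Variable T : finType.

Definition log2 (x : R) : R := ln x / ln 2.

Definition normalized (f : {set T} -> R) := f set0 = 0.
Definition nonneg_fun (f : {set T} -> R) := forall X, 0 <= f X.
Definition monotone (f : {set T} -> R) :=
  forall X Y : {set T}, X \subset Y -> f X <= f Y.
Definition submodular (f : {set T} -> R) :=
  forall X Y : {set T}, f (X :|: Y) + f (X :&: Y) <= f X + f Y.

(* A subroutine: A k' X is the ordered output (v_1,...,v_k') *)
Definition subroutine := nat -> {set T} -> seq T.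

Definition Apref (A : subroutine) (k' : nat) (X : {set T}) (i : nat) : {set T} :=
  [set x in take i (A k' X)].

Definition valid_subroutine (A : subroutine) :=
  forall (k' : nat) (X : {set T}), (k' <= #|X|)%N ->
    [/\ size (A k' X) = k', uniq (A k' X) & {subset A k' X <= X}].

(* beta-iterative property; "max over v in X" written as "for every v in X" *)
Definition beta_iterative (f : {set T} -> R) (beta : R) (A : subroutine) :=
  forall (k' : nat) (X : {set T}) (i : nat) (v : T),
    (k' <= #|X|)%N -> (i < k')%N -> v \in X ->
    f (Apref A k' X i.+1) - f (Apref A k' X i) >=
      (f (v |: Apref A k' X i) - f (Apref A k' X i)) / beta.

Definition ceil_div (m d : nat) : nat := ((m + d.-1) %/ d)%N.

Definition pro_step (A : subroutine) (sz : nat) (S0 : {set T}) : {set T} :=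
  S0 :|: [set x in A sz (~: S0)].

Definition PRo_S0 (A : subroutine) (tau eta : nat) : {set T} :=
  foldl (fun S0 i => iter (ceil_div tau (2 ^ i)) (pro_step A (2 ^ i * eta)) S0)
        set0 (iota 0 (up_log 2 tau).+1).

Definition PRo_S1 (A : subroutine) (k tau eta : nat) : {set T} :=
  let S0 := PRo_S0 A tau eta in [set x in A (k - #|S0|)%N (~: S0)].

Definition PRo (A : subroutine) (k tau eta : nat) : {set T} :=
  PRo_S0 A tau eta :|: PRo_S1 A k tau eta.

Definition robust_val (f : {set T} -> R) (tau : nat) (S : {set T}) : R :=
  \big[Order.min/f S]_(E : {set T} | (E \subset S) && (#|E| <= tau)%N) f (S :\: E).

(* f(OPT(k,V,tau) \ E*_OPT) = max over |S| = k of robust_val (f >= 0) *)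
Definition opt_robust_val (f : {set T} -> R) (k tau : nat) : R :=
  \big[Order.max/0]_(S : {set T} | #|S| == k) robust_val f tau S.

End Defs.

Definition rho {R : realType} (beta : R) : R :=
  (1 - expR (- (1 / beta))) / (2 - expR (- (1 / beta))).

Definition pro_hyps {R : realType} {T : finType} (f : {set T} -> R)
  (A : subroutine T) (beta : R) (k tau eta : nat) : Prop :=
  [/\ normalized f, nonneg_fun f, monotone f & submodular f] /\
  [/\ valid_subroutine A, beta_iterative f beta A & 1 <= beta ] /\
  [/\ (k <= #|T|)%N, (0 < eta)%N,
      (eta%:R : R) >= 4 * (log2 (k%:R) + 1),
      (2 <= tau)%N &
      (tau%:R : R) <= k%:R / (3 * eta%:R * (log2 (k%:R) + 2)) ].

(* Main.v *)
(* Write a = f(S \ E), E0 = E :&: S0, E1 = E :\: S0, L = up_log 2 tau.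

   If a bucket B of n elements is built from X and meets E in at most s
   elements, then the n - s surviving elements each gained at least 1/beta times
   the final marginal of any v in X, so (n - s) f(v | B) <= beta f(B \ E).
   By pigeonhole every stage i has a bucket B_i meeting E in at most 2^i
   elements, and B_0 misses E as soon as E1 is nonempty.  The elements of
   B_(i+1) :&: E were available when B_i was built, so the loss
   f(B_i :&: E | S \ E) grows by at most 2 beta a / (eta - 1) from i to i + 1,
   whence f(E1 | S \ E) <= (2 L + 1) beta a / (eta - 1) <= 5 beta^3 L a / eta.
   Therefore f(S1) <= (1 + 5 beta^3 L / eta) a.

   An optimal set, with E0 and further elements (tau altogether) removed, leaves
   a set O of k - tau elements with f(O) <= f(S0 \ E0) + f(O \ S0) <=
   a + f(O \ S0), while the greedy estimate for S1 gives c f(O \ S0) <= a.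
   Eliminating f(O \ S0) yields a >= c / (1 + c) f(O). *)
Require Import Defs.
From mathcomp Require Import all_boot all_order all_algebra.
From mathcomp Require Import reals sequences exp.
From mathcomp Require Import zify ring lra.
Import Order.TTheory GRing.Theory Num.Theory.
Local Open Scope ring_scope.

(** * Marginal gains of monotone submodular functions *)

Section Submodular.
Context {R : realType} {T : finType} {f : {set T} -> R}.
Hypothesis f_mono : Defs.monotone f.
Hypothesis f_sub : submodular f.

(** Submodularity for [Z :|: X] and [Y]: their union is [Z :|: Y] and their intersection contains
    [X]. *)
Lemma marginal_anti (X Y Z : {set T}) :
  X \subset Y -> f (Z :|: Y) - f Y <= f (Z :|: X) - f X.
Proof.
move=> sXY; have := f_sub (Z :|: X) Y.
rewrite -setUA (setUidPr sXY).
have : f X <= f ((Z :|: X) :&: Y) by apply: f_mono; rewrite subsetI subsetUr sXY.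
lra.
Qed.

Lemma marginal_ge0 (X Z : {set T}) : 0 <= f (Z :|: X) - f X.
Proof. by rewrite subr_ge0 f_mono ?subsetUr. Qed.

(** Peel off [G] one element at a time; by diminishing returns, each gains no more over the rest
    than over [B] alone. *)
Lemma marginal_le_card (G B : {set T}) (d : R) :
    (forall v, v \in G -> f (v |: B) - f B <= d) ->
  f (G :|: B) - f B <= #|G|%:R * d.
Proof.
have [n] := ubnP #|G|; elim: n G => // n IHn G; rewrite ltnS => leGn Gd.
have [->|[v vG]] := set_0Vmem G.
  by rewrite set0U subrr cards0 mul0r.
have Ev : G = v |: G :\ v by rewrite setD1K.
have cG : #|G| = #|G :\ v|.+1 by rewrite (cardsD1 v) vG.
have := IHn (G :\ v); rewrite -cG => /(_ leGn) {}IHn.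
have {}IHn : f (G :\ v :|: B) - f B <= #|G :\ v|%:R * d.
  by apply: IHn => u /setD1P[_ /Gd].
have := marginal_anti B (G :\ v :|: B) [set v] (subsetUr _ _).
rewrite setUA -Ev cG -natr1 mulrDl mul1r.
have := Gd v vG; lra.
Qed.

Lemma submodularU (X Y : {set T}) : 0 <= f (X :&: Y) -> f (X :|: Y) <= f X + f Y.
Proof. by have := f_sub X Y; lra. Qed.

(* Only the elements of the run [s] outside [E] are counted: their marginal
   gains over [E]-free prefixes dominate those over full prefixes. *)
Lemma steps_setD_ge (s : seq T) (E : {set T}) (d : R) (n : nat) :
    uniq s -> f set0 = 0 ->
    (forall i, (i < size s)%N ->
       d <= f [set x in take i.+1 s] - f [set x in take i s]) ->
    (n <= size s)%N ->
  (n%:R - #|[set x in take n s] :&: E|%:R) * d <= f ([set x in take n s] :\: E).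
Proof.
move=> us f0 sd; elim: n => [|n IHn] ltns.
  have -> : [set x in take 0 s] = set0 by rewrite take0; apply/setP=> x; rewrite !inE.
  by rewrite set0I set0D cards0 f0 subrr mul0r.
have {}IHn := IHn (ltnW ltns); have := sd _ ltns.
have x0 : T by case: (s) ltns.
set b := nth x0 s n.
have bP : b \notin take n s.
  have := take_uniq n.+1 us.
  by rewrite (take_nth x0 ltns) rcons_uniq => /andP[].
have -> : [set x in take n.+1 s] = b |: [set x in take n s].
  by apply/setP=> x; rewrite (take_nth x0 ltns) !inE mem_rcons inE.
set P := [set x in take n s] in IHn *.
have {}bP : b \notin P by rewrite inE.
have [bE|bE] := boolP (b \in E).
  have -> : (b |: P) :\: E = P :\: E.
    by apply/setP=> x; rewrite !inE; case: eqP => // ->; rewrite bE.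
  have -> : (b |: P) :&: E = b |: (P :&: E).
    by apply/setP=> x; rewrite !inE; case: eqP => // ->; rewrite bE.
  rewrite cardsU1 inE (negPf bP) /= => _.
  by apply: le_trans IHn; rewrite add1n -!natr1 opprD addrACA subrr addr0.
have -> : (b |: P) :\: E = b |: (P :\: E).
  by apply/setP=> x; rewrite !inE; case: eqP => // ->; rewrite bE.
have -> : (b |: P) :&: E = P :&: E.
  by apply/setP=> x; rewrite !inE; case: eqP => // ->; rewrite (negPf bE) !andbF.
have := marginal_anti (P :\: E) P [set b] (subsetDl _ _).
rewrite -natr1; lra.
Qed.

End Submodular.

(** * Consequences of the iterative property for a single run *)

Section Subroutine.
Context {R : realType} {T : finType} {f : {set T} -> R}.
Context {A : subroutine T} {beta : R}.
Hypothesis f0 : normalized f.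
Hypothesis f_ge0 : nonneg_fun f.
Hypothesis f_mono : Defs.monotone f.
Hypothesis f_sub : submodular f.
Hypothesis A_valid : valid_subroutine A.
Hypothesis A_iter : beta_iterative f beta A.
Hypothesis beta_ge1 : 1 <= beta.

Let beta_gt0 : 0 < beta. Proof. exact: lt_le_trans beta_ge1. Qed.

Lemma card_run n (X : {set T}) : (n <= #|X|)%N -> #|[set x in A n X]| = n.
Proof. by move=> /A_valid[sz us _]; rewrite cardsE (card_uniqP us). Qed.

Lemma run_sub n (X : {set T}) : (n <= #|X|)%N -> [set x in A n X] \subset X.
Proof. by move=> /A_valid[_ _ sAX]; apply/subsetP=> x; rewrite inE => /sAX. Qed.

Lemma Apref_run n (X : {set T}) : (n <= #|X|)%N -> Apref A n X n = [set x in A n X].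
Proof. by move=> /A_valid[sz _ _]; rewrite /Apref -{1}sz take_size. Qed.

Lemma Apref_sub n (X : {set T}) i j : (i <= j)%N -> Apref A n X i \subset Apref A n X j.
Proof.
move=> leij; apply/subsetP=> x; rewrite !inE -(subnKC leij) takeD mem_cat.
by move=> ->.
Qed.

(** Each step gains at least [1 / beta] times the marginal of [v] over the current prefix, hence
    over the whole run by diminishing returns. This uniform bound feeds [steps_setD_ge]. *)
Lemma marginal_run_le n (X E : {set T}) v :
    (n <= #|X|)%N -> v \in X ->
  (n%:R - #|[set x in A n X] :&: E|%:R) *
    (f (v |: [set x in A n X]) - f [set x in A n X]) <=
  beta * f ([set x in A n X] :\: E).
Proof.
move=> leX vX; set B := [set x in A n X]; have [sz us _] := A_valid _ _ leX.
have := steps_setD_ge f_mono f_sub (A n X) E ((f (v |: B) - f B) / beta) n us f0.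
rewrite -/(Apref A n X n) (Apref_run _ _ leX) sz -/B mulrA ler_pdivrMr //.
rewrite [beta * _]mulrC; apply => // i ltin.
apply: le_trans (A_iter n X i v leX ltin vX).
rewrite ler_pM2r ?invr_gt0 //; apply: (marginal_anti f_mono f_sub).
by rewrite /B -(Apref_run _ _ leX) Apref_sub // ltnW.
Qed.

(** Greedy recursion: each step shrinks the gap to [f O] by the factor [q = 1 - 1 / (beta * m)], and
    [q ^+ n] is at most the exponential. A bound [m] replaces the size of [O] because the comparison
    set will be [O :\: S0], of unknown size at most [k - tau]. *)
Lemma run_approx n (X O : {set T}) (m : R) :
    (n <= #|X|)%N -> O \subset X -> #|O|%:R <= m -> 1 <= m ->
  (1 - expR (- (n%:R / (beta * m)))) * f O <= f [set x in A n X].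
Proof.
move=> leX sOX leOm m1.
have bm1 : 1 <= beta * m by rewrite mulr_ege1.
have bm0 : 0 < beta * m by exact: lt_le_trans bm1.
pose q := 1 - (beta * m)^-1.
have q0 : 0 <= q by rewrite subr_ge0 invf_le1.
have step i : (i < n)%N ->
    f O - f (Apref A n X i.+1) <= q * (f O - f (Apref A n X i)).
  move=> ltin; set P := Apref A n X i; set P' := Apref A n X i.+1.
  have P'P : 0 <= f P' - f P by rewrite subr_ge0 f_mono // Apref_sub.
  have H : f (O :|: P) - f P <= #|O|%:R * (beta * (f P' - f P)).
    apply: marginal_le_card => // v vO.
    have := A_iter n X i v leX ltin (subsetP sOX _ vO).
    by rewrite -/P -/P' ler_pdivrMr // mulrC.
  have H1 : f O - f P <= (beta * m) * (f P' - f P).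
    apply: (@le_trans _ _ (f (O :|: P) - f P)).
      by rewrite lerD2r f_mono ?subsetUl.
    apply: le_trans H _; rewrite [beta * m]mulrC -mulrA; apply: ler_wpM2r => //.
    by rewrite mulr_ge0 // ltW.
  have H2 : (f O - f P) / (beta * m) <= f P' - f P by rewrite ler_pdivrMr // mulrC.
  rewrite /q mulrBl mul1r [_^-1 * _]mulrC; lra.
have all i : (i <= n)%N -> f O - f (Apref A n X i) <= q ^+ i * f O.
  elim: i => [|i IHi] lein; first by rewrite expr0 mul1r gerBl f_ge0.
  apply: le_trans (step _ lein) _; rewrite exprS -mulrA ler_wpM2l //.
  exact/IHi/ltnW.
have := all n (leqnn n); rewrite (Apref_run _ _ leX).
suff: q ^+ n * f O <= expR (- (n%:R / (beta * m))) * f O by lra.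
apply: ler_wpM2r; first exact: f_ge0.
rewrite -mulrN expRM_natl; apply: lerXn2r; rewrite ?nnegrE ?expR_ge0 //.
exact: expR_ge1Dx.
Qed.

End Subroutine.

(** * Bucket construction: disjointness, pigeonhole and sizes *)

Section Buckets.
Context {T : finType} {A : subroutine T}.
Hypothesis A_valid : valid_subroutine A.

Lemma step_sub n (S : {set T}) : S \subset pro_step A n S.
Proof. exact: subsetUl. Qed.

Lemma iter_step_sub N n (S : {set T}) : S \subset iter N (pro_step A n) S.
Proof. by elim: N => //= N IHN; apply: subset_trans IHN (step_sub _ _). Qed.

Lemma card_setC_ge n (S : {set T}) : (#|S| + n <= #|T|)%N -> (n <= #|~: S|)%N.
Proof. by have := cardsC S; lia. Qed.

Lemma card_step n (S : {set T}) :
  (#|S| + n <= #|T|)%N -> #|pro_step A n S| = (#|S| + n)%N.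
Proof.
move=> /card_setC_ge len; rewrite /pro_step cardsU disjoint_setI0.
  by rewrite cards0 subn0 card_run.
by rewrite disjoint_sym disjoints_subset run_sub.
Qed.

Lemma card_iter_step N n (S : {set T}) : (#|S| + N * n <= #|T|)%N ->
  #|iter N (pro_step A n) S| = (#|S| + N * n)%N.
Proof.
elim: N => [|N IHN] leN; first by rewrite mul0n addn0.
have /IHN {}IHN : (#|S| + N * n <= #|T|)%N by lia.
by rewrite /= card_step IHN; lia.
Qed.

(** Pigeonhole over the [N] disjoint buckets of a stage. The witness [X] is the pool from which the
    sparse bucket was drawn, so it contains everything still unselected when the stage ends. *)
Lemma sparse_bucket N n m (S E : {set T}) : (#|S| + N * n <= #|T|)%N ->
    (#|iter N (pro_step A n) S :&: E| < N * m.+1)%N ->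
  exists X : {set T}, [/\ (n <= #|X|)%N, X \subset ~: S,
    [set x in A n X] \subset iter N (pro_step A n) S,
    ~: iter N (pro_step A n) S \subset X & (#|[set x in A n X] :&: E| <= m)%N].
Proof.
move=> leT ltE.
(* The strict bound on [E] concerns only the final [N]; a dichotomy can be proved by induction
   without it. *)
suff : (N * m.+1 <= #|iter N (pro_step A n) S :&: E|)%N \/
  exists X : {set T}, [/\ (n <= #|X|)%N, X \subset ~: S,
    [set x in A n X] \subset iter N (pro_step A n) S,
    ~: iter N (pro_step A n) S \subset X & (#|[set x in A n X] :&: E| <= m)%N].
  by case=> //; rewrite leqNgt ltE.
elim: N leT {ltE} => [|N IHN] leT; first by left.
have leT' : (#|S| + N * n <= #|T|)%N by lia.
have [le|[X [h1 h2 h3 h4 h5]]] := IHN leT'; last first.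
  right; exists X; split=> //=.
    exact: subset_trans h3 (step_sub _ _).
  by apply: subset_trans h4; rewrite setCS step_sub.
have leX : (n <= #|~: iter N (pro_step A n) S|)%N.
  by apply: card_setC_ge; rewrite card_iter_step //; lia.
have sX := run_sub A_valid _ _ leX.
have [leE|gtE] := leqP #|[set x in A n (~: iter N (pro_step A n) S)] :&: E| m.
  right; exists (~: iter N (pro_step A n) S); split => //=.
  - by rewrite setCS iter_step_sub.
  - exact: subsetUr.
  - by rewrite setCS step_sub.
left; rewrite /= /pro_step setIUl cardsU.
set I1 := _ :&: E in le *; set I2 := _ :&: E in gtE *.
have -> : I1 :&: I2 = set0.
  apply: disjoint_setI0; rewrite disjoint_sym disjoints_subset.
  apply: subset_trans (subsetIl _ _) _; apply: subset_trans sX _.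
  by rewrite setCS subsetIl.
by rewrite cards0; lia.
Qed.

Context {tau eta : nat}.

(* [PRo_S0 A tau eta] is convertible to [stages (up_log 2 tau).+1]. *)
Definition stages (n : nat) : {set T} :=
  foldl (fun S0 i => iter (ceil_div tau (2 ^ i)) (pro_step A (2 ^ i * eta)) S0)
        set0 (iota 0 n).

Definition stages_size (n : nat) : nat :=
  \sum_(i < n) ceil_div tau (2 ^ i) * (2 ^ i * eta).

Lemma stagesS n :
  stages n.+1 = iter (ceil_div tau (2 ^ n)) (pro_step A (2 ^ n * eta)) (stages n).
Proof. by rewrite /stages -[n.+1]addn1 iotaD foldl_cat. Qed.

Lemma stages_sub m n : (m <= n)%N -> stages m \subset stages n.
Proof.
move=> /subnKC <-; elim: (n - m)%N => [|d IHd]; first by rewrite addn0.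
by rewrite addnS stagesS; apply: subset_trans IHd (iter_step_sub _ _ _).
Qed.

Lemma stages_sizeS n : stages_size n.+1 =
  (stages_size n + ceil_div tau (2 ^ n) * (2 ^ n * eta))%N.
Proof. exact: big_ord_recr. Qed.

Lemma card_stages n : (stages_size n <= #|T|)%N -> #|stages n| = stages_size n.
Proof.
elim: n => [|n IHn]; first by rewrite /stages_size big_ord0 /stages /= cards0.
rewrite stages_sizeS => len; rewrite stagesS card_iter_step IHn //; lia.
Qed.

Lemma ceil_div_mul_ge d : (0 < d)%N -> (tau <= ceil_div tau d * d)%N.
Proof.
move=> d0; have := divn_eq (tau + d.-1) d; have := ltn_pmod (tau + d.-1) d0.
by rewrite /ceil_div; lia.
Qed.

Lemma ceil_div_mul_le d : (0 < d)%N -> (ceil_div tau d * d <= tau + d)%N.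
Proof.
move=> d0; have := leq_divM (tau + d.-1) d.
by rewrite /ceil_div; lia.
Qed.

(** Rounding up costs stage [i] at most [2 ^ i * eta] elements beyond [tau * eta], a geometric
    sum. *)
Lemma stages_size_le n : (stages_size n <= eta * (n * tau + 2 ^ n))%N.
Proof.
elim: n => [|n IHn]; first by rewrite /stages_size big_ord0.
have d0 : (0 < 2 ^ n)%N by rewrite expn_gt0.
have H : (ceil_div tau (2 ^ n) * (2 ^ n * eta) <= (tau + 2 ^ n) * eta)%N.
  by rewrite mulnA leq_mul2r ceil_div_mul_le ?orbT.
by rewrite stages_sizeS expnS; lia.
Qed.

End Buckets.
Arguments stages {T} A tau eta n.

(** * Value lost by deleting [E], bounded along the stages *)

Section Loss.
Context {R : realType} {T : finType} {f : {set T} -> R}.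
Context {A : subroutine T} {beta : R} {tau eta : nat}.
Hypothesis f0 : normalized f.
Hypothesis f_ge0 : nonneg_fun f.
Hypothesis f_mono : Defs.monotone f.
Hypothesis f_sub : submodular f.
Hypothesis A_valid : valid_subroutine A.
Hypothesis A_iter : beta_iterative f beta A.
Hypothesis beta_ge1 : 1 <= beta.
Hypothesis tau_gt0 : (0 < tau)%N.
Hypothesis eta_gt1 : (1 < eta)%N.

Let beta_gt0 : 0 < beta. Proof. exact: lt_le_trans beta_ge1. Qed.
Let eta_gt1R : 0 < eta%:R - 1 :> R. Proof. by rewrite subr_gt0 ltr1n. Qed.

(** As [B :\: E] lies in [D], adding [B :&: E] to [D] covers all of [B]; over this larger set [G]
    gains no more than over [B], hence at most [m * d]. *)
Lemma transfer_loss (B G E D : {set T}) (m d : R) :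
    B :\: E \subset D -> 0 <= d -> #|G|%:R <= m ->
    (forall v, v \in G -> f (v |: B) - f B <= d) ->
  f (G :|: D) - f D <= f (B :&: E :|: D) - f D + m * d.
Proof.
move=> sBD d0 Gm Gd; set Y := B :&: E :|: D.
have sBY : B \subset Y.
  apply/subsetP=> x xB; rewrite !inE xB /=.
  by case: (boolP (x \in E)) => //= xE; rewrite (subsetP sBD) // !inE xE.
have h1 := marginal_anti f_mono f_sub B Y G sBY.
have h2 := marginal_le_card f_mono f_sub G B d Gd.
have h3 : f (G :|: D) <= f (G :|: Y) by apply: f_mono; rewrite setUS ?subsetUr.
have h4 : #|G|%:R * d <= m * d by rewrite ler_wpM2r.
lra.
Qed.

(** Of the [2 ^ i * eta] elements of the sparse bucket at most [2 ^ i] are deleted, which leaves the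
    denominator [2 ^ i * (eta - 1)]. The survivors lie in [D], so their value is at most [f D]. *)
Lemma sparse_stage (E D : {set T}) (i m : nat) :
    (stages_size (tau := tau) (eta := eta) i.+1 <= #|T|)%N ->
    (#|stages A tau eta i.+1 :&: E| < ceil_div tau (2 ^ i) * m.+1)%N ->
    (m <= 2 ^ i)%N -> stages A tau eta i.+1 :\: E \subset D ->
  exists B : {set T}, [/\ B \subset stages A tau eta i.+1,
    B \subset ~: stages A tau eta i, (#|B :&: E| <= m)%N &
    forall v, v \notin stages A tau eta i.+1 ->
      f (v |: B) - f B <= beta * f D / ((2 ^ i)%:R * (eta%:R - 1))].
Proof.
move=> leT ltE lem sD; rewrite stages_sizeS in leT.
rewrite stagesS in ltE sD *.
have [|X [h1 h2 h3 h4 h5]] := sparse_bucket A_valid _ _ m (stages A tau eta i) E _ ltE.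
  by rewrite (card_stages A_valid) //; lia.
have p0 : 0 < (2 ^ i)%:R * (eta%:R - 1) :> R.
  by rewrite mulr_gt0 // ltr0n expn_gt0.
exists [set x in A (2 ^ i * eta)%N X]; split => //.
  exact: subset_trans (run_sub A_valid _ _ h1) h2.
move=> v vN; have vX : v \in X by rewrite (subsetP h4) // inE.
rewrite ler_pdivlMr // mulrC.
have := marginal_run_le f0 f_mono f_sub A_valid A_iter beta_ge1 _ X E v h1 vX.
set B := [set x in _] in h3 h5 *.
move=> H; apply: le_trans (le_trans H _).
  apply: ler_wpM2r; first exact: marginal_ge0.
  rewrite natrM mulrBr mulr1 lerD2l lerN2 ler_nat; exact: leq_trans h5 lem.
rewrite ler_pM2l //; apply: f_mono; apply: subset_trans sD.
exact: setSD.
Qed.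

(* The loss f(B_i :&: E | D) grows only additively in [i]: elements of
   B_(i+1) :&: E were available, and rejected, when B_i was built. *)
Lemma bucket_chain (E D : {set T}) (n i : nat) :
    (stages_size (tau := tau) (eta := eta) n <= #|T|)%N ->
    stages A tau eta n :\: E \subset D -> (#|E| <= tau)%N ->
    (#|stages A tau eta n :&: E| < tau)%N -> (i < n)%N ->
  exists B : {set T}, [/\ B :\: E \subset D,
    f (B :&: E :|: D) - f D <= i%:R * (2 * beta * f D / (eta%:R - 1)) &
    forall v, v \notin stages A tau eta i.+1 ->
      f (v |: B) - f B <= beta * f D / ((2 ^ i)%:R * (eta%:R - 1))].
Proof.
move=> leT sD leE ltE.
have szm j : (j <= n)%N ->
    (stages_size (tau := tau) (eta := eta) j <= #|T|)%N.
  move=> lej; apply: leq_trans leT; rewrite -(subnKC lej).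
  elim: (n - j)%N => [|d IHd]; first by rewrite addn0.
  by rewrite addnS stages_sizeS; lia.
have sD' j : (j <= n)%N -> stages A tau eta j :\: E \subset D.
  by move=> lej; apply: subset_trans sD; apply: setSD; apply: stages_sub.
elim: i => [|i IHi] lti.
  (* Stage 0 has [tau] buckets and meets fewer than [tau] elements of [E], so some bucket misses [E]
     and the chain starts with zero loss. *)
  have [|//||B [h1 h2 h3 h4]] := sparse_stage E D 0 0 (szm _ lti).
  - apply: (@leq_trans tau).
      apply: leq_ltn_trans ltE; apply: subset_leq_card; apply: setSI.
      exact: stages_sub.
    by have := ceil_div_mul_ge (tau := tau) (2 ^ 0) isT; rewrite expn0.
  - exact: sD'.
  exists B; split => //; first by apply: subset_trans (sD' _ lti); exact: setSD.
  move: h3; rewrite leqn0 cards_eq0 => /eqP ->.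
  by rewrite set0U subrr mul0r.
have [B [h1 h2 h3]] := IHi (ltnW lti).
have d0 : (0 < 2 ^ i.+1)%N by rewrite expn_gt0.
(* If every bucket had more than [2 ^ i.+1] elements of [E], their total would exceed [tau]. *)
have [|//||B' [k1 k2 k3 k4]] := sparse_stage E D i.+1 (2 ^ i.+1) (szm _ lti).
- apply: leq_ltn_trans (_ : #|E| < _)%N; first by rewrite subset_leq_card ?subsetIr.
  by have := ceil_div_mul_ge (tau := tau) _ d0; rewrite mulnS; case: ceil_div => [|c]; lia.
- exact: sD'.
exists B'; split => //; first by apply: subset_trans (sD' _ lti); exact: setSD.
have H : forall v, v \in B' :&: E ->
    f (v |: B) - f B <= beta * f D / ((2 ^ i)%:R * (eta%:R - 1)).
  move=> v /setIP[vB' _]; apply: h3.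
  by have := subsetP k2 _ vB'; rewrite inE.
have Hd : 0 <= beta * f D / ((2 ^ i)%:R * (eta%:R - 1)).
  apply: divr_ge0; first exact: mulr_ge0 (ltW beta_gt0) (f_ge0 _).
  by rewrite mulr_ge0 ?ler0n // ltW.
have k3R : #|B' :&: E|%:R <= (2 ^ i.+1)%:R :> R by rewrite ler_nat.
apply: le_trans (transfer_loss B (B' :&: E) E D _ _ h1 Hd k3R H) _.
(* The next bucket may lose twice as many elements as the denominator [2 ^ i] accounts for: this is
   the factor 2 per stage. *)
rewrite -[i.+1%:R]natr1 mulrDl mul1r lerD // expnS natrM.
have p0 : (2 ^ i)%:R != 0 :> R by rewrite pnatr_eq0 -lt0n expn_gt0.
have e0 : eta%:R - 1 != 0 :> R by rewrite gt_eqF.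
by rewrite le_eqVlt; apply/orP; left; apply/eqP; field; rewrite p0 e0.
Qed.

(** Last link of the chain: elements of [E] never selected in the stages were available to the
    bucket of stage [n]. There are at most [2 ^ n] of them, so they add one unit to the [2 * n]
    units lost so far. *)
Lemma outer_loss (E D : {set T}) (n : nat) :
    (stages_size (tau := tau) (eta := eta) n.+1 <= #|T|)%N ->
    stages A tau eta n.+1 :\: E \subset D -> (#|E| <= tau)%N ->
    (tau <= 2 ^ n)%N ->
  f (E :\: stages A tau eta n.+1 :|: D) - f D <=
    (2 * n%:R + 1) * (beta * f D / (eta%:R - 1)).
Proof.
move=> leT sD leE letau.
have P0 : 0 <= beta * f D / (eta%:R - 1).
  by apply: divr_ge0; [exact: mulr_ge0 (ltW beta_gt0) (f_ge0 _)|exact: ltW].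
have [->|[x xE]] := set_0Vmem (E :\: stages A tau eta n.+1).
  by rewrite set0U subrr mulr_ge0 // addr_ge0 // mulr_ge0.
(* The element [x] outside the stages gives the strict inequality that stage 0 needs. *)
have ltE : (#|stages A tau eta n.+1 :&: E| < tau)%N.
  rewrite setIC; apply: leq_trans leE.
  have := cardsID (stages A tau eta n.+1) E.
  by rewrite (cardsD1 x (E :\: _)) xE; lia.
have [B [h1 h2 h3]] := bucket_chain E D n.+1 n leT sD leE ltE (ltnSn n).
have Hd : 0 <= beta * f D / ((2 ^ n)%:R * (eta%:R - 1)).
  apply: divr_ge0; first exact: mulr_ge0 (ltW beta_gt0) (f_ge0 _).
  by rewrite mulr_ge0 ?ler0n // ltW.
have kR : #|E :\: stages A tau eta n.+1|%:R <= (2 ^ n)%:R :> R.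
  rewrite ler_nat; apply: leq_trans letau; apply: leq_trans leE.
  by rewrite subset_leq_card ?subsetDl.
have H : forall v, v \in E :\: stages A tau eta n.+1 ->
    f (v |: B) - f B <= beta * f D / ((2 ^ n)%:R * (eta%:R - 1)).
  by move=> v /setDP[_ vN]; apply: h3.
apply: le_trans (transfer_loss B _ E D _ _ h1 Hd kR H) _.
have p0 : (2 ^ n)%:R != 0 :> R by rewrite pnatr_eq0 -lt0n expn_gt0.
have e0 : eta%:R - 1 != 0 :> R by rewrite gt_eqF.
rewrite mulrDl mul1r lerD //.
  by apply: le_trans h2 _; rewrite le_eqVlt; apply/orP; left; apply/eqP; field.
by rewrite le_eqVlt; apply/orP; left; apply/eqP; field; rewrite p0 e0.
Qed.

End Loss.

(** * Robust values, and the arithmetic of the final ratio *)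

Lemma subset_of_card {T : finType} (X : {set T}) (n : nat) : (n <= #|X|)%N ->
  exists2 Y : {set T}, Y \subset X & #|Y| = n.
Proof.
move=> len; exists [set x in take n (enum X)].
  by apply/subsetP=> x; rewrite inE => /mem_take; rewrite mem_enum.
by rewrite cardsE (card_uniqP (take_uniq _ (enum_uniq _))) size_takel // -cardE.
Qed.

Section RobustVal.
Context {R : realType} {T : finType} (f : {set T} -> R).

Lemma robust_val_le (tau : nat) (S E : {set T}) :
  E \subset S -> (#|E| <= tau)%N -> robust_val f tau S <= f (S :\: E).
Proof.
by move=> sES leE; rewrite /robust_val; apply: bigmin_le_cond; rewrite sES leE.
Qed.

Lemma robust_val_ge (tau : nat) (S : {set T}) (x : R) :
    (forall E : {set T}, E \subset S -> (#|E| <= tau)%N -> x <= f (S :\: E)) ->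
  x <= robust_val f tau S.
Proof.
move=> H; apply: le_bigmin => [|E /andP[]]; last exact: H.
by rewrite -[S in f S]setD0; apply: H; rewrite ?sub0set ?cards0.
Qed.

Lemma opt_robust_val_ge0 (k tau : nat) : 0 <= opt_robust_val f k tau.
Proof. exact: bigmax_ge_id. Qed.

Lemma opt_robust_val_le (k tau : nat) (q x : R) : 0 <= x ->
    (forall S : {set T}, #|S| = k -> q * robust_val f tau S <= x) ->
  q * opt_robust_val f k tau <= x.
Proof.
move=> x0 H; rewrite /opt_robust_val; elim/big_ind: _ => [|y z hy hz|S /eqP].
- by rewrite mulr0.
- by rewrite maxEle; case: ifP.
- exact: H.
Qed.

(* Delete from [S] its intersection with [X], padded to exactly [tau] elements. *)
Lemma robust_val_le_disjoint (k tau : nat) (S X : {set T}) :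
    #|S| = k -> (tau <= k)%N -> (#|X| <= tau)%N ->
  exists O : {set T}, [/\ #|O| = (k - tau)%N, O \subset ~: X &
    robust_val f tau S <= f O].
Proof.
move=> cS letau leX.
have [|O sO cO] := subset_of_card (S :\: X) (k - tau).
  have := cardsID X S; have := subset_leq_card (subsetIr S X); lia.
exists O; split => //; first by move: sO; rewrite setDE subsetI => /andP[].
have sOS : O \subset S by apply: subset_trans sO (subsetDl _ _).
have -> : O = S :\: (S :\: O) by rewrite setDDr setDv set0U; apply/esym/setIidPr.
apply: robust_val_le; first exact: subsetDl.
have := cardsID O S; rewrite (setIidPr sOS); lia.
Qed.

End RobustVal.

(** Here [a] stands for the surviving value and [W] for the value of the optimum outside [S0]. *)
Lemma ratio_bound {R : realType} (c a O W : R) :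
  0 <= c -> O <= a + W -> c * W <= a -> c / (1 + c) * O <= a.
Proof.
move=> c0 hO hW; have c1 : 0 < 1 + c by lra.
rewrite mulrAC ler_pdivrMr //.
have := ler_wpM2l c0 hO; lra.
Qed.

(** Since [2 * L + 1 <= 3 * L] and [eta / (eta - 1) <= 4 / 3], the factor 5 is enough; [beta] is
    relaxed to its cube. *)
Lemma loss_coef {R : realType} (beta L eta : R) : 1 <= beta -> 1 <= L -> 4 <= eta ->
  1 + (2 * L + 1) * (beta / (eta - 1)) <= (5 * beta ^+ 3 * L + eta) / eta.
Proof.
move=> b1 L1 e4.
have e0 : eta != 0 by rewrite gt_eqF; lra.
have e1 : 0 < eta - 1 by lra.
have -> : (5 * beta ^+ 3 * L + eta) / eta = 1 + 5 * beta ^+ 3 * L / eta by field.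
rewrite lerD2l mulrA ler_pdivrMr // mulrAC ler_pdivlMr; last lra.
have bb : beta <= beta ^+ 3 by rewrite ler_eXnr.
have h1 : (2 * L + 1) * eta <= 5 * L * (eta - 1) by nra.
have h2 : (2 * L + 1) * eta * beta <= 5 * L * (eta - 1) * beta.
  by apply: ler_wpM2r => //; lra.
have h3 : 5 * L * (eta - 1) * beta <= 5 * L * (eta - 1) * beta ^+ 3.
  by apply: ler_wpM2l => //; apply: mulr_ge0; lra.
lra.
Qed.

(** * Numerical consequences of the parameter hypotheses *)

Section Budget.
Context {R : realType}.

Lemma ln2_gt0 : 0 < ln 2 :> R.
Proof. by apply: ln_gt0; rewrite ltr1n. Qed.

Lemma log2_ge0 (x : R) : 1 <= x -> 0 <= log2 x.
Proof. by move=> x1; apply: divr_ge0; [exact: ln_ge0|exact: ltW ln2_gt0]. Qed.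

Lemma le_log2 (n k : nat) : (2 ^ n <= k)%N -> n%:R <= log2 (k%:R : R).
Proof.
move=> le; rewrite ler_pdivlMr ?ln2_gt0 //.
have -> : n%:R * ln 2 = ln ((2 : R) ^+ n) by rewrite lnXn // mulr_natl.
rewrite ler_ln ?posrE ?exprn_gt0 // -?natrX ?ler_nat //.
by rewrite ltr0n; apply: leq_trans le; rewrite expn_gt0.
Qed.

Lemma pro_params (beta : R) (k tau eta : nat) :
    (eta%:R : R) >= 4 * (log2 (k%:R) + 1) -> (2 <= tau)%N ->
    (tau%:R : R) <= k%:R / (3 * eta%:R * (log2 (k%:R) + 2)) ->
  [/\ 0 <= log2 (k%:R : R), (tau < k)%N,
    (1 : R) <= (up_log 2 tau)%:R <= log2 (k%:R : R) + 1,
    (stages_size (tau := tau) (eta := eta) (up_log 2 tau).+1)%:R <=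
      tau%:R * eta%:R * (log2 (k%:R : R) + 6) &
    (stages_size (tau := tau) (eta := eta) (up_log 2 tau).+1 <= k)%N].
Proof.
set lk := log2 _; set L := up_log 2 tau => heta htau hk.
have k0 : (0 < k)%N.
  case: k @lk heta hk => // lk heta; rewrite mul0r.
  by rewrite (lern0 R tau) => /eqP tau0; rewrite tau0 in htau.
have lk0 : 0 <= lk by apply: log2_ge0; rewrite ler1n.
have tau2 : 2 <= tau%:R :> R by rewrite ler_nat.
have p0 : 0 < 3 * eta%:R * (lk + 2) by apply: mulr_gt0; lra.
move: hk; rewrite ler_pdivlMr // => hk.
set t := tau%:R in tau2 hk *; set e := eta%:R in heta p0 hk *.
have te0 : 0 <= t * e by apply: mulr_ge0; lra.
have te8 : 4 * t <= t * e by rewrite mulrC; apply: ler_wpM2l; lra.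
have tek : 6 * (t * e) + 3 * (t * e * lk) <= k%:R.
  by apply: le_trans hk; rewrite le_eqVlt; apply/orP; left; apply/eqP; ring.
have telk : 0 <= t * e * lk by apply: mulr_ge0.
have tauk : (tau < k)%N by rewrite -(ltr_nat R) -/t; lra.
have L0 : (0 < L)%N by rewrite /L up_log_gt0.
have /andP[pL _] := up_log_bounds (isT : (1 < 2)%N) htau.
rewrite -/L in pL.
have Llk : L%:R <= lk + 1.
  rewrite -(prednK L0) -natr1 lerD2r; apply: le_log2; lia.
have sz : (stages_size (tau := tau) (eta := eta) L.+1)%:R <= t * e * (lk + 6).
  (* The power [2 ^ L.+1] is four times [2 ^ L.-1], which is below [tau]. *)
  apply: (@le_trans _ _ ((eta * (L.+1 * tau + 4 * tau))%N%:R)).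
    rewrite ler_nat; apply: leq_trans (stages_size_le _) _.
    rewrite leq_mul2l leq_add2l -(prednK L0) !expnS mulnA leq_mul2l /=.
    by rewrite (ltnW pL) !orbT.
  rewrite natrM natrD !natrM -[L.+1%:R]natr1 -/t -/e.
  have -> : e * ((L%:R + 1) * t + 4 * t) = t * e * (L%:R + 5) by ring.
  by apply: ler_wpM2l => //; lra.
split => //; first by rewrite ler1n L0 Llk.
rewrite -(ler_nat R); apply: le_trans sz _; lra.
Qed.

End Budget.

(** * The finite guarantee *)

Section Guarantee.
Context {R : realType}.

(** The constant [c] of the theorem, with [s0] for the size of [S0]. *)
Definition pro_ratio (beta : R) (k tau eta s0 : nat) : R :=
  (eta%:R / (5 * beta ^+ 3 * (up_log 2 tau)%:R + eta%:R)) *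
  (1 - expR (- ((k - s0)%N%:R / (beta * (k%:R - tau%:R))))).

Lemma pro_ratio_ge0 (beta : R) (k tau eta s0 : nat) : 1 <= beta -> (tau < k)%N ->
  0 <= pro_ratio beta k tau eta s0.
Proof.
move=> b1 ltk.
have b0 : 0 < beta by lra.
have kt : 0 < k%:R - tau%:R :> R by rewrite subr_gt0 ltr_nat.
apply: mulr_ge0.
  have b3 : 0 <= beta ^+ 3 by apply: exprn_ge0; exact: ltW.
  apply: divr_ge0 => //; apply: addr_ge0 => //.
  by apply: mulr_ge0 => //; apply: mulr_ge0.
rewrite subr_ge0 expR_le1 oppr_le0 divr_ge0 // mulr_ge0 // ltW //.
Qed.

Lemma pro_guarantee (T : finType) (f : {set T} -> R) (A : subroutine T) (beta : R)
    (k tau eta : nat) : pro_hyps f A beta k tau eta ->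
  let c := pro_ratio beta k tau eta #|PRo_S0 A tau eta| in
  #|PRo A k tau eta| = k /\
  robust_val f tau (PRo A k tau eta) >= c / (1 + c) * opt_robust_val f k tau.
Proof.
case=> [[f0 f_ge0 f_mono f_sub] [[A_valid A_iter b1] [leT eta0 heta htau hk]]].
have [lk0 ltk /andP[L1 _] _ szk] := pro_params beta k tau eta heta htau hk.
have eta4 : 4 <= eta%:R :> R by lra.
have szT := leq_trans szk leT.
rewrite /PRo /PRo_S1; set S0 := PRo_S0 A tau eta; set L := up_log 2 tau in L1 szk szT *.
have ES0 : S0 = stages A tau eta L.+1 by [].
have cS0 := card_stages A_valid L.+1 szT; rewrite -ES0 in cS0.
have leX : (k - #|S0| <= #|~: S0|)%N by apply: card_setC_ge; lia.
set S1 := [set x in A _ _]; set S := S0 :|: S1.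
have sS1 : S1 \subset ~: S0 := run_sub A_valid _ _ leX.
have cS : #|S| = k.
  rewrite /S cardsU disjoint_setI0; last by rewrite disjoint_sym disjoints_subset.
  rewrite cards0 /S1 (card_run A_valid) //; lia.
split => //; set c := pro_ratio _ _ _ _ _.
have c0 : 0 <= c by apply: pro_ratio_ge0.
have c10 : 0 < 1 + c by lra.
apply: robust_val_ge => E sE leE; set D := S :\: E.
apply: opt_robust_val_le => [|O' cO']; first exact: f_ge0.
have leES0 : (#|E :&: S0| <= tau)%N.
  by apply: leq_trans leE; rewrite subset_leq_card ?subsetIl.
have [O [cO sO leO]] := robust_val_le_disjoint f k tau O' (E :&: S0) cO' (ltnW ltk) leES0.
apply: le_trans (ler_wpM2l (divr_ge0 c0 (ltW c10)) leO) _.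
apply: (ratio_bound c _ _ (f (O :\: S0))) => //.
  (* [O] avoids [E :&: S0], so its elements inside [S0] all survive in [D]. *)
  apply: (@le_trans _ _ (f (D :|: (O :\: S0)))).
    apply: f_mono; apply/subsetP=> x xO; have := subsetP sO _ xO.
    rewrite /D /S !(in_setC, in_setI, in_setU, in_setD) xO.
    by case: (x \in S0); case: (x \in E); rewrite ?orbT.
  by apply: (submodularU f_sub); exact: f_ge0.
have loss : f S1 <= (5 * beta ^+ 3 * L%:R + eta%:R) / eta%:R * f D.
  have eta1 : (1 < eta)%N by rewrite -(ltr_nat R); lra.
  have leT2 : (tau <= 2 ^ L)%N by exact: up_logP.
  have sD : stages A tau eta L.+1 :\: E \subset D by rewrite -ES0 setSD // subsetUl.
  have := outer_loss f0 f_ge0 f_mono f_sub A_valid A_iter b1 (ltnW htau) eta1 E D L szT sD leE leT2.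
  rewrite -ES0 => out.
  have sS1' : S1 \subset E :\: S0 :|: D.
    apply/subsetP=> x xS1; have := subsetP sS1 _ xS1.
    by rewrite /D /S !in_setU !in_setD in_setU in_setC xS1 => ->; case: (x \in E); rewrite ?orbT.
  apply: (@le_trans _ _ (f (E :\: S0 :|: D))); first exact: f_mono.
  have := ler_wpM2r (f_ge0 D) (loss_coef beta L%:R eta%:R b1 L1 eta4).
  rewrite mulrDl mul1r mulrAC; move: out; rewrite mulrAC; lra.
have kt1 : 1 <= k%:R - tau%:R :> R.
  by rewrite lerBrDr addrC natr1 ler_nat.
have cOm : #|O :\: S0|%:R <= k%:R - tau%:R :> R.
  rewrite -natrB ?(ltnW ltk) // ler_nat -cO; exact: subset_leq_card (subsetDl _ _).
have sOX : O :\: S0 \subset ~: S0 by rewrite setDE subsetIr.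
(* [O :\: S0] was available to the final run, which produced [S1]. *)
have approx := run_approx f_ge0 f_mono f_sub A_valid A_iter b1 _ _ _ _ leX sOX cOm kt1.
have den0 : 0 < 5 * beta ^+ 3 * L%:R + eta%:R.
  have b3 : 0 <= beta ^+ 3 by apply: exprn_ge0; lra.
  apply: ltr_wpDl; last lra.
  by apply: mulr_ge0 => //; apply: mulr_ge0.
have eta0R : 0 < eta%:R :> R by rewrite ltr0n.
have := le_trans approx loss; rewrite mulrAC ler_pdivlMr // => bound.
rewrite /c /pro_ratio -/L -[_ * _ * f _]mulrA mulrAC ler_pdivrMr //.
by rewrite [f D * _]mulrC; apply: le_trans bound; rewrite mulrC.
Qed.

End Guarantee.

(** * Limit of the ratio and numerical values *)

Section Asymptotics.
Context {R : realType}.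

(** Exhibits [rho] as [c' / (1 + c')] for the limit [c'] of [c]. *)
Lemma rhoE (beta : R) :
  rho beta = (1 - expR (- (1 / beta))) / (1 + (1 - expR (- (1 / beta)))).
Proof. by rewrite /rho; congr (_ / _); ring. Qed.

(** One-sided Lipschitz bound with constant 1, from the tangent inequality at [x - y] scaled by
    [expR (- x) <= 1]. *)
Lemma expRN_le (x y d : R) : 0 <= x -> 0 <= d -> y - d <= x ->
  expR (- x) <= expR (- y) + d.
Proof.
move=> x0 d0 yx; have [leyx|ltxy] := leP y x.
  by apply: ler_wpDr => //; rewrite ler_expR lerN2.
have -> : - y = - x + (x - y) by ring.
have ex1 : expR (- x) <= 1 by rewrite expR_le1 oppr_le0.
have := ler_wpM2l (expR_ge0 (- x)) (expR_ge1Dx (x - y)).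
have : expR (- x) * (y - x) <= 1 * (y - x) by apply: ler_wpM2r => //; lra.
rewrite -expRD; lra.
Qed.

Lemma harmonic_ratio_lower (c c' eps : R) : 0 <= c -> 0 <= c' -> 0 <= eps -> c' - eps <= c ->
  c' / (1 + c') - eps <= c / (1 + c).
Proof.
move=> c0 c0' e0 H.
have p : 0 < 1 + c by lra.
have p' : 0 < 1 + c' by lra.
rewrite lerBlDr ler_pdivrMr // -subr_ge0.
have -> : (c / (1 + c) + eps) * (1 + c') - c' =
    (c - c' + eps * (1 + c) * (1 + c')) / (1 + c) by field; lra.
apply: divr_ge0; last exact: ltW.
have : eps * 1 <= eps * ((1 + c) * (1 + c')) by apply: ler_wpM2l => //; nra.
lra.
Qed.

(** Each of the two factors [u], [v] of the ratio is within [eps / 2] of its limit; as [u <= 1] and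
    [v <= 1], the two errors add. *)
Lemma pro_ratio_lower (beta eps : R) (k tau eta s0 : nat) :
    1 <= beta -> 0 < eps -> (tau < k)%N -> (s0 <= k)%N ->
    let lk := log2 (k%:R : R) in
    20 * beta ^+ 3 / eps + 1 <= lk ->
    (up_log 2 tau)%:R <= lk + 1 ->
    s0%:R <= tau%:R * eta%:R * (lk + 6) ->
    tau%:R * eta%:R * lk <= eps / 14 * k%:R ->
    lk ^+ 2 <= eta%:R ->
  1 - expR (- (1 / beta)) - eps <= pro_ratio beta k tau eta s0.
Proof.
move=> b1 e0 ltk lek lk hlk hL hs hte heta; rewrite /pro_ratio.
set L := (up_log 2 tau)%:R; rewrite -/L in hL.
have L0 : 0 <= L by apply: ler0n.
have b3 : 0 <= beta ^+ 3 by apply: exprn_ge0; lra.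
have k0 : 0 < k%:R :> R by rewrite ltr0n; lia.
have kt : 0 < k%:R - tau%:R :> R by rewrite subr_gt0 ltr_nat.
have q0 : 0 <= 20 * beta ^+ 3 / eps by apply: divr_ge0; [lra|exact: ltW].
have lk1 : 1 <= lk by lra.
have eta1 : 1 <= eta%:R :> R by apply: le_trans heta; exact: exprn_ege1.
have hb : 20 * beta ^+ 3 <= eps * lk.
  by rewrite [eps * _]mulrC -ler_pdivrMr //; lra.
set u := eta%:R / _; set v := 1 - expR (- (_%:R / _)).
have bL0 : 0 <= beta ^+ 3 * L by apply: mulr_ge0.
(* [L <= 2 * lk] turns 5 into 10, and [20 * beta ^+ 3 <= eps * lk] then gives
   [eps / 2 * lk ^+ 2]. *)
have hX : 5 * beta ^+ 3 * L <= eps / 2 * eta%:R.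
  have h1 : beta ^+ 3 * L <= beta ^+ 3 * (2 * lk) by apply: ler_wpM2l => //; lra.
  have h2 : 20 * beta ^+ 3 * lk <= eps * lk * lk by apply: ler_wpM2r => //; lra.
  have h3 : eps * (lk ^+ 2) <= eps * eta%:R by apply: ler_wpM2l => //; exact: ltW.
  lra.
have den0 : 0 < 5 * beta ^+ 3 * L + eta%:R by lra.
have u1 : 1 - eps / 2 <= u.
  rewrite ler_pdivlMr //.
  have : 0 <= eps / 2 * (5 * beta ^+ 3 * L) by apply: mulr_ge0; lra.
  lra.
have ule1 : u <= 1 by rewrite ler_pdivrMr // mul1r; lra.
have x0 : 0 <= (k - s0)%N%:R / (beta * (k%:R - tau%:R)).
  by apply: divr_ge0 => //; apply: mulr_ge0; lra.
have hx : 1 / beta - eps / 2 <= (k - s0)%N%:R / (beta * (k%:R - tau%:R)).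
  (* [lk + 6 <= 7 * lk], and 7 times [eps / 14] is [eps / 2]. *)
  have hs7 : s0%:R <= eps / 2 * k%:R.
    have te0 : 0 <= tau%:R * eta%:R :> R by apply: mulr_ge0.
    have := ler_wpM2l te0 (_ : lk + 6 <= 7 * lk); lra.
  apply: (@le_trans _ _ ((1 - eps / 2) / beta)).
    rewrite mulrBl lerB // -[leRHS]mulr1 ler_wpM2l ?invf_le1 //; lra.
  rewrite invfM mulrCA mulrC ler_wpM2l ?invr_ge0 //; first lra.
  rewrite ler_pdivlMr // natrB //.
  (* [eps] may exceed 2; the left side is then nonpositive. *)
  have [e2|e2] := leP 0 (1 - eps / 2).
    have : (1 - eps / 2) * (k%:R - tau%:R) <= (1 - eps / 2) * k%:R.
      by apply: ler_wpM2l => //; rewrite gerBl.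
    lra.
  have : (1 - eps / 2) * (k%:R - tau%:R) <= 0 by apply: mulr_le0_ge0; lra.
  have : s0%:R <= k%:R :> R by rewrite ler_nat.
  lra.
have hv : 1 - expR (- (1 / beta)) - eps / 2 <= v.
  have e20 : 0 <= eps / 2 by lra.
  by have := expRN_le _ _ _ x0 e20 hx; rewrite /v; lra.
have v1 : v <= 1 by rewrite /v gerBl expR_ge0.
have v0 : 0 <= v by rewrite /v subr_ge0 expR_le1 oppr_le0.
have : (1 - u) * v <= (1 - u) * 1 by apply: ler_wpM2l => //; rewrite subr_ge0.
lra.
Qed.

(** The sum of the first six terms of the exponential series; five terms would be too few for
    0.387. *)
Lemma expR1_ge : 163 / 60 <= expR 1 :> R.
Proof.
have cv := is_cvg_series_exp_coeff (1 : R).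
have nd : nondecreasing_seq (series (exp_coeff (1 : R))).
  apply/nondecreasing_seqP => n; rewrite seriesSr lerDl /exp_coeff /=.
  by rewrite expr1n divr_ge0.
apply: le_trans (nondecreasing_cvgn_le nd cv 6); rewrite /series /=.
rewrite !big_nat_recr //= big_geq // /exp_coeff /= !expr1n !factS fact0.
lra.
Qed.

Lemma rho1_ge : 387%:R / 1000%:R <= rho (1 : R).
Proof.
rewrite /rho divr1 expRN; set q := (expR 1)^-1.
have e0 : 0 < expR 1 :> R by exact: expR_gt0.
have q0 : 0 <= q by rewrite invr_ge0 ltW.
have qe : q * expR 1 = 1 by apply: mulVf; rewrite gt_eqF.
have := ler_wpM2l q0 expR1_ge; rewrite qe => hq.
rewrite ler_pdivlMr; lra.
Qed.

(* [t |-> rho (1 / t)] is concave and vanishes at [0]; the convexity of [exp]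
   comes from its tangent line at [- t]. *)
Lemma rho_inv_ge (t : R) : 0 < t <= 1 -> t * rho 1 <= rho (1 / t).
Proof.
move=> /andP[t0 t1]; rewrite !rhoE divr1 !div1r invrK.
set c := 1 - expR (- t); set c1 := 1 - expR (- 1).
have c10 : 0 <= c1 by rewrite subr_ge0 expR_le1 oppr_le0.
have tc : t * c1 <= c.
  have h1 : expR (- t) * (1 + t) <= 1.
    have := ler_wpM2l (expR_ge0 (- t)) (expR_ge1Dx t).
    by rewrite -expRD addNr expR0.
  have h2 : expR (- t) * t <= expR (- 1).
    have := ler_wpM2l (expR_ge0 (- t)) (expR_ge1Dx (t - 1)).
    rewrite -expRD (_ : - t + (t - 1) = - 1); last by ring.
    by rewrite addrCA subrr addr0.
  (* Weighting [h1] by [1 - t] and [h2] by [t] gives the chord bound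
     [expR (- t) <= 1 - t + t * expR (- 1)]. *)
  rewrite /c /c1.
  have := ler_wpM2l (ltW t0) h2; have : 0 <= 1 - t by lra.
  move=> /ler_wpM2l/(_ _ _ h1); lra.
have c0 : 0 <= c by apply: le_trans tc; apply: mulr_ge0 => //; exact: ltW.
rewrite mulrA ler_pdivlMr; last lra.
rewrite mulrAC ler_pdivrMr; last lra.
have : t * c1 * c <= 1 * c1 * c by apply: ler_wpM2r => //; apply: ler_wpM2r.
nra.
Qed.

End Asymptotics.

Theorem theorem1 (R : realType) :
  (* finite guarantee *)
  (forall (T : finType) (f : {set T} -> R) (A : subroutine T) (beta : R)
          (k tau eta : nat),
     pro_hyps f A beta k tau eta ->
     let S0 := PRo_S0 A tau eta in
     let S := PRo A k tau eta in
     let c := (eta%:R / (5 * beta ^+ 3 * (up_log 2 tau)%:R + eta%:R)) *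
              (1 - expR (- ((k - #|S0|)%N%:R / (beta * (k%:R - tau%:R))))) in
     #|S| = k /\ robust_val f tau S >= c / (1 + c) * opt_robust_val f k tau) /\
  (* asymptotic guarantee: tau = o(k/(eta log k)), eta >= log^2 k, k -> oo *)
  (forall beta : R, 1 <= beta -> forall eps : R, 0 < eps ->
     exists delta : R, 0 < delta /\ exists K : nat,
     forall (T : finType) (f : {set T} -> R) (A : subroutine T) (k tau eta : nat),
       pro_hyps f A beta k tau eta -> (K <= k)%N ->
       tau%:R * eta%:R * log2 k%:R <= delta * k%:R ->
       log2 (k%:R : R) ^+ 2 <= eta%:R ->
       robust_val f tau (PRo A k tau eta) >=
         (rho beta - eps) * opt_robust_val f k tau) /\
  (* numerical consequences *)
  rho (1 : R) >= 387%:R / 1000%:R /\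
  (forall eps : R, 0 <= eps < 1 ->
     rho (1 / (1 - eps)) >= 387%:R / 1000%:R * (1 - eps)).
Proof.
split; first exact: pro_guarantee.
split; last first.
  split; first exact: rho1_ge.
  move=> eps /andP[e0 e1].
  have t01 : 0 < 1 - eps <= 1 by apply/andP; split; lra.
  apply: le_trans (rho_inv_ge _ t01).
  rewrite mulrC; apply: ler_wpM2l rho1_ge; lra.
move=> beta b1 eps e0; exists (eps / 14); split; first lra.
set M := 20 * beta ^+ 3 / eps + 1.
have M0 : 0 <= M.
  have b3 : 0 <= beta ^+ 3 by apply: exprn_ge0; lra.
  by apply: addr_ge0 => //; apply: divr_ge0; lra.
(* This threshold forces [log2 k] above [M], the bound required by [pro_ratio_lower]. *)
exists (2 ^ Num.bound M)%N => T f A k tau eta hyps leK hte heta.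
have lkM : M <= log2 (k%:R : R).
  by apply: le_trans (le_log2 _ _ leK); apply: ltW; exact: archi_boundP.
have [_ guarantee] := pro_guarantee _ _ _ _ _ _ _ hyps.
case: hyps => [_ [[A_valid _ _] [leT _ eta4 tau2 hk]]].
have [lk0 ltk /andP[_ Llk] sz szk] := pro_params beta k tau eta eta4 tau2 hk.
have cS0 : #|PRo_S0 A tau eta| = stages_size (tau := tau) (eta := eta) (up_log 2 tau).+1.
  exact: (card_stages A_valid (up_log 2 tau).+1 (leq_trans szk leT)).
apply: le_trans guarantee; apply: ler_wpM2r; first exact: opt_robust_val_ge0.
rewrite rhoE; apply: harmonic_ratio_lower.
- exact: pro_ratio_ge0.
- by rewrite subr_ge0 expR_le1 oppr_le0 divr_ge0 //; lra.
- exact: ltW.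
- by apply: pro_ratio_lower => //; rewrite cS0.
Qed.
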